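(* Let $K$ be a field and let $G$ be a finite simple graph with vertex set $\{x_1,\dots,x_n\}$. Let $I(G)\subset S=K[x_1,\dots,x_n]$ be its edge ideal and let $c(G)$ be the number of connected components of $G$. Then, for all $k\gg0$, $$\mathrm{v}(I(G)^k)\ =\ 2k+(c(G)-2).$$
   Context: The edge ideal of a finite simple graph $G$ with vertex set $\{x_1,\dots,x_n\}$ and edge set $E(G)$ is $I(G)=(x_ix_j:\{x_i,x_j\}\in E(G))\subset S=K[x_1,\dots,x_n]$, where $S$ is standard graded. For an ideal $L\subset S$, $\operatorname{Ass}(L)$ denotes the set of associated primes of $S/L$. For a graded ideal $L$ and $\mathfrak{p}\in\operatorname{Ass}(L)$, $\mathrm{v}_{\mathfrak{p}}(L)$ is the least degree of a homogeneous polynomial $f$ such that $(L:f)=\mathfrak{p}$, and $\mathrm{v}(L)=\min_{\mathfrak{p}\in\operatorname{Ass}(L)}\mathrm{v}_{\mathfrak{p}}(L)$. ''For all $k\gg0$'' means for all sufficiently large integers $k$.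
   Formalization: The graph G is assumed to be non-empty and without isolated vertices; otherwise the formula fails: for the edge {x1,x2} plus an isolated vertex x3, v(I(G)^k)=2k-1 while 2k+c(G)-2=2k, and if G has no edges v(I(G)^k)=0 for k>=1. *)

(* Defs.v *)
From mathcomp Require Import all_boot all_order all_algebra.
From mathcomp Require Import mpoly.

Set Implicit Arguments.
Unset Strict Implicit.
Unset Printing Implicit Defensive.

Import GRing.Theory.
Local Open Scope ring_scope.

Section Ideals.
Variable R : comNzRingType.

(* Ideals are Prop-valued subsets: the boolean [idealr] of ring_quotient would
   impose decidable membership. *)
Implicit Types (A I J L P : R -> Prop).

Definition is_ideal I : Prop :=
  [/\ I 0, forall a b, I a -> I b -> I (a + b) & forall a b, I b -> I (a * b)].

Definition is_prime_ideal P : Prop :=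
  [/\ is_ideal P, ~ P 1 & forall a b, P (a * b) -> P a \/ P b].

Definition ideal_gen A : R -> Prop := fun x =>
  exists2 s : seq (R * R),
    forall ab, ab \in s -> A ab.2 & x = \sum_(ab <- s) ab.1 * ab.2.

Definition ideal_mul I J : R -> Prop :=
  ideal_gen (fun x => exists a b, [/\ I a, J b & x = a * b]).

Definition ideal_exp I (k : nat) : R -> Prop :=
  iter k (ideal_mul I) (fun=> True).

Definition colon L (f : R) : R -> Prop := fun g => L (g * f).

Definition ideal_eq I J : Prop := forall x, I x <-> J x.

(* [colon L f] is the annihilator of the class of [f] in R/L, so this says that
   [P] is an associated prime of the R-module R/L. *)
Definition is_assoc_prime L P : Prop :=
  is_prime_ideal P /\ exists f, ideal_eq (colon L f) P.

End Ideals.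

Definition is_least (Q : nat -> Prop) (d : nat) : Prop :=
  Q d /\ forall m, Q m -> (d <= m)%N.

Section VNumber.
Variables (n : nat) (K : fieldType).
Implicit Types (L P : {mpoly K[n]} -> Prop).

Definition is_local_vnumber L P (d : nat) : Prop :=
  is_least (fun m => exists2 f : {mpoly K[n]},
    f \is m.-homog & ideal_eq (colon L f) P) d.

Definition is_vnumber L (d : nat) : Prop :=
  is_least (fun m => exists2 P,
    is_assoc_prime L P & is_local_vnumber L P m) d.

End VNumber.

Section Graphs.
Variable n : nat.

Definition edge_ideal (K : fieldType) (e : rel 'I_n) : {mpoly K[n]} -> Prop :=
  ideal_gen (fun f => exists i j, e i j /\ f = 'X_i * 'X_j).

Definition num_components (e : rel 'I_n) : nat := n_comp e predT.

(* An isolated vertex raises the number of components but leaves the edge ideal,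
   hence the v-numbers of its powers, essentially unchanged: the formula
   v(I(G)^k) = 2k + c(G) - 2 holds only for graphs without isolated vertices. *)
Definition no_isolated_vertices (e : rel 'I_n) : Prop :=
  forall i, exists j, e i j.

End Graphs.

Arguments edge_ideal {n} K e _.

(* Main.v *)
(** A monomial lies in [I(G)^k] iff it is divisible by a product of [k] edges.

    Lower bound: let [(I^k : f) = P] be prime and let [x^m] be a term of [f]
    outside [I^k].  The variables in [P] form a vertex cover [C], and
    [x_i x^m] lies in [I^k] for [i] in [C].  Let [M] be [k-1] edges dividing
    [x^m].  Every component contains some [i] in [C]; by maximality, the edges
    dividing [x_i x^m] contain more edges of this component than [M] does, so
    [x^m / M] has positive degree in each component.

    Upper bound: take [F] to be the product of one root per component and of
    [k-1] edges.  Let [B] be the set of vertices joined to their root by a walk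
    of odd length: one side of a bipartite component, all of a non-bipartite
    one.  If the [k-1] edges contain every second edge of such walks, then
    [x_w F] is in [I^k] for each [w] in [B], and a weight that gives each edge
    the value 2 and vanishes off [B] shows that [(I^k : F)] is exactly the
    prime ideal generated by [B]. *)

Require Import Defs.
From mathcomp Require Import all_boot all_order all_algebra.
From mathcomp Require Import mpoly.
From Stdlib Require Classical_Prop.
From mathcomp Require Import zify.

Set Implicit Arguments.
Unset Strict Implicit.
Unset Printing Implicit Defensive.

Import GRing.Theory.
Local Open Scope ring_scope.

(** * Generated ideals, their powers, and primes *)

Section IdealFacts.
Context {R : comNzRingType}.
Implicit Types (A I J : R -> Prop) (k : nat).

Lemma ideal_gen_ideal A : is_ideal (ideal_gen A).
Proof.
split.
- by exists [::] => //; rewrite big_nil.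
- move=> a b [s As ->] [t At ->]; exists (s ++ t); last by rewrite big_cat.
  by move=> x; rewrite mem_cat => /orP[/As|/At].
- move=> a b [s As ->]; exists [seq (a * x.1, x.2) | x <- s].
    by move=> _ /mapP[x xs ->]; apply: (As x).
  by rewrite big_map mulr_sumr; apply: eq_bigr => x _; rewrite mulrA.
Qed.

Lemma ideal_gen_sub A I : is_ideal I -> (forall a, A a -> I a) ->
  forall a, ideal_gen A a -> I a.
Proof.
move=> [I0 ID IM] AI _ [s As ->].
rewrite big_seq; elim/big_rec: _ => [|x a xs Ia]; first exact: I0.
by apply: ID => //; apply/IM/AI/As.
Qed.

Lemma ideal_gen_incl A a : A a -> ideal_gen A a.
Proof.
move=> Aa; exists [:: (1, a)]; last by rewrite big_seq1 mul1r.
by move=> x; rewrite inE => /eqP->.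
Qed.

Lemma ideal_exp_ideal I k : is_ideal (ideal_exp I k).
Proof. by case: k => [|k]; [split | apply: ideal_gen_ideal]. Qed.

Lemma prime_ideal_exp (P : R -> Prop) a k : is_prime_ideal P -> P (a ^+ k) -> P a.
Proof.
move=> [_ P1 PM]; elim: k => [|k IHk]; first by rewrite expr0.
by rewrite exprS => /PM[].
Qed.

End IdealFacts.

(** * Monomials in powers of the edge ideal *)

Section EdgePowers.
Context {n : nat}.
Implicit Types (e : rel 'I_n) (s t : seq ('I_n * 'I_n)) (m : 'X_{1..n}) (k : nat).

Definition edge_mnm s : 'X_{1..n} := (\sum_(a <- s) (U_(a.1) + U_(a.2)))%MM.

Definition edges e s : bool := all (fun a => e a.1 a.2) s.

(** Membership of [x^m] in the [k]-th power, read on exponents. The list stands for a multiset of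
    edges; allowing more than [k] of them avoids truncating lists. *)
Definition packs e k m : Prop :=
  exists s, [/\ edges e s, (k <= size s)%N & (edge_mnm s <= m)%MM].

Lemma edge_mnm_nil : edge_mnm [::] = 0%MM.
Proof. by rewrite /edge_mnm big_nil. Qed.

Lemma edge_mnm_cons a s : edge_mnm (a :: s) = (U_(a.1) + U_(a.2) + edge_mnm s)%MM.
Proof. by rewrite /edge_mnm big_cons. Qed.

Lemma edge_mnm_cat s t : edge_mnm (s ++ t) = (edge_mnm s + edge_mnm t)%MM.
Proof. by rewrite /edge_mnm big_cat. Qed.

Lemma packs_le e k m m' : (m <= m')%MM -> packs e k m -> packs e k m'.
Proof. by move=> le [s [es ks sm]]; exists s; split=> //; apply: lepm_trans le. Qed.

Lemma mdeg_edge_mnm s : mdeg (edge_mnm s) = (2 * size s)%N.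
Proof.
elim: s => [|a s IHs]; first by rewrite edge_mnm_nil mdeg0.
by rewrite edge_mnm_cons !mdegD !mdeg1 IHs mulnS.
Qed.

Context {K : fieldType}.
Implicit Types (f g : {mpoly K[n]}).

(** With [ideal_gen_sub], this carries packing from the generators to every term of every element:
    the power is a monomial ideal. *)
Lemma packed_ideal e k :
  is_ideal (fun f : {mpoly K[n]} => forall m, m \in msupp f -> packs e k m).
Proof.
split.
- by move=> m; rewrite msupp0.
- by move=> f g pf pg m /msuppD_le; rewrite mem_cat => /orP[/pf|/pg].
- move=> f g pg m /msuppM_le /allpairsP[[m1 m2] /= [_ /pg pm2 ->]].
  exact: packs_le (lem_addl _ _) pm2.
Qed.

Lemma edge_ideal_packs e f : edge_ideal K e f ->
  forall m, m \in msupp f -> packs e 1 m.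
Proof.
apply: (ideal_gen_sub (packed_ideal e 1)) => _ [i [j [eij ->]]] m.
rewrite -mpolyXD msuppX inE => /eqP->; exists [:: (i, j)].
by rewrite /edges /= eij edge_mnm_cons edge_mnm_nil addm0; split => //; apply: lepm_refl.
Qed.

Lemma ideal_exp_packs e k f : ideal_exp (edge_ideal K e) k f ->
  forall m, m \in msupp f -> packs e k m.
Proof.
elim: k f => [|k IHk] f.
  move=> _ m _; exists [::]; split=> //.
  by rewrite edge_mnm_nil; apply/mnm_lepP => i; rewrite mnm0E.
apply: (ideal_gen_sub (packed_ideal e k.+1)) => _ [a [b [Ia Ib ->]]] m.
case/msuppM_le/allpairsP=> -[m1 m2] /= [/(edge_ideal_packs Ia) [s [es ks sm]]].
case/(IHk _ Ib) => t [et kt tm] ->; exists (s ++ t); split.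
- by rewrite /edges all_cat; apply/andP.
- by rewrite size_cat -add1n leq_add.
- rewrite edge_mnm_cat; apply/mnm_lepP => i; rewrite !mnmDE.
  by apply: leq_add; apply/mnm_lepP: i.
Qed.

Lemma edge_mnm_ideal_exp e k s : edges e s -> (k <= size s)%N ->
  ideal_exp (edge_ideal K e) k 'X_[edge_mnm s].
Proof.
elim: k s => [//|k IHk] [//|[i j] s] /= /andP[eij es] ks.
apply: ideal_gen_incl; exists ('X_i * 'X_j), 'X_[edge_mnm s].
split; first by apply: ideal_gen_incl; exists i, j.
  exact: IHk.
by rewrite edge_mnm_cons -!mpolyXD.
Qed.

Lemma packs_ideal_exp e k f : (forall m, m \in msupp f -> packs e k m) ->
  ideal_exp (edge_ideal K e) k f.
Proof.
have [I0 ID IM] := ideal_exp_ideal (edge_ideal K e) k.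
move=> pf; rewrite (mpolyE f) big_seq; elim/big_rec: _ => // m g /pf[s [es ks sm]] Ig.
apply: ID => //; rewrite -(submK sm) mpolyXD -mul_mpolyC mulrA; apply: IM.
exact: edge_mnm_ideal_exp.
Qed.

End EdgePowers.

(* The prime ideal generated by the variables in [B], as the kernel of the
   substitution sending them to [0]. *)
Section VariableIdeal.
Context {n : nat} {K : fieldType} (B : pred 'I_n).

Definition kill_vars : n.-tuple {mpoly K[n]} :=
  [tuple (if B i then 0 else 'X_i) | i < n].

Definition var_ideal (f : {mpoly K[n]}) : Prop := f \mPo kill_vars = 0.

Lemma var_ideal_prime : is_prime_ideal var_ideal.
Proof.
rewrite /var_ideal; split; first split.
- exact: comp_mpoly0.
- by move=> a b a0 b0; rewrite comp_mpolyD a0 b0 addr0.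
- by move=> a b b0; rewrite rmorphM /= b0 mulr0.
- by rewrite comp_mpoly1; apply/eqP/oner_neq0.
- by move=> a b; rewrite rmorphM /= => /eqP; rewrite mulf_eq0 => /orP[]/eqP; [left|right].
Qed.

Lemma kill_varsX (m : 'X_{1..n}) :
  'X_[m] \mPo kill_vars =
  if [exists i, B i && (0 < m i)%N] then 0 else 'X_[m] :> {mpoly K[n]}.
Proof.
rewrite comp_mpolyX; case: existsP => [[i /andP[Bi mi]]|noB].
  by rewrite (bigD1 i) //= tnth_mktuple Bi expr0n eqn0Ngt mi /= mul0r.
rewrite mpolyXE_id; apply: eq_bigr => i _; rewrite tnth_mktuple.
case Bi: (B i) => //; case: (posnP (m i)) => [-> //|mi].
by case: noB; exists i; rewrite Bi.
Qed.

(** The substitution fixes the monomials free of [B] and kills the others, so surviving terms cannot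
    cancel. *)
Lemma var_idealP (f : {mpoly K[n]}) :
  var_ideal f <-> forall m, m \in msupp f -> exists2 i, B i & (0 < m i)%N.
Proof.
rewrite /var_ideal {1}(mpolyE f) linear_sum /=.
split=> [f0 m mf|fB]; last first.
  rewrite big_seq big1 // => m /fB[i Bi mi]; rewrite linearZ /= kill_varsX.
  by case: existsP => [_|[]]; rewrite ?scaler0 //; exists i; rewrite Bi.
have: 'X_[m] \mPo kill_vars = 0 :> {mpoly K[n]}.
  rewrite kill_varsX; case: ifP => // noB.
  move/(congr1 (mcoeff m)): f0; rewrite linear_sum /= mcoeff0.
  rewrite (bigD1_seq m) ?msupp_uniq //= linearZ /= kill_varsX noB mcoeffZ mcoeffX.
  rewrite eqxx mulr1 big1 ?addr0 => [fm0|m' m'm].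
    by rewrite mcoeff_msupp fm0 eqxx in mf.
  rewrite linearZ /= kill_varsX; case: ifP => _; rewrite ?scaler0 ?mcoeff0 //.
  by rewrite mcoeffZ mcoeffX (negPf m'm) mulr0.
rewrite kill_varsX; case: existsP => [[i /andP[]]|_ /eqP]; first by exists i.
by rewrite -msupp_eq0 msuppX.
Qed.

End VariableIdeal.

(** * Edge counts per component and the lower bound *)

Section Components.
Context {n : nat} (e : rel 'I_n).
Hypotheses (e_sym : ssrbool.symmetric e) (e_noisol : no_isolated_vertices e).
Implicit Types (s t g h : seq ('I_n * 'I_n)) (m : 'X_{1..n}) (k : nat).

Local Notation comp := (fingraph.root e).

Let e_csym : connect_sym e := sym_connect_sym e_sym.

Definition comp_count (r : 'I_n) s : nat := count (fun a => comp a.1 == r) s.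

Lemma edge_comp i j : e i j -> comp i = comp j.
Proof. by move=> eij; apply/(fingraph.rootP e_csym)/connect1. Qed.

Lemma edge_mnmE s v : edge_mnm s v = (\sum_(a <- s) ((a.1 == v) + (a.2 == v)))%N.
Proof. by rewrite mnm_sumE; apply: eq_bigr => a _; rewrite mnmDE !mnm1E. Qed.

(** Both ends of an edge have the same root, so testing the first end suffices. *)
Lemma edge_mnm_comp (p : pred 'I_n) s v : edges e s ->
  edge_mnm [seq a <- s | p (comp a.1)] v = if p (comp v) then edge_mnm s v else 0%N.
Proof.
move/allP=> es; transitivity (\sum_(a <- s) if p (comp v) then (a.1 == v) + (a.2 == v) else 0)%N.
  rewrite edge_mnmE big_filter big_mkcond; apply: eq_big_seq => a /es/edge_comp ea.
  have [<- //|av1] := eqVneq a.1 v; have [<-|av2] := eqVneq a.2 v; first by rewrite ea.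
  by rewrite !if_same.
by case: ifP => _; [rewrite edge_mnmE | rewrite big1].
Qed.

(** Double counting of incidences. For the lower bound [w] is the indicator of a component, for the
    upper bound [parity_weight] restricted to one. *)
Lemma edge_mnm_weight (w : 'I_n -> nat) (r : 'I_n) s : edges e s ->
  (forall i j, e i j -> w i + w j = 2 * (comp i == r))%N ->
  (\sum_v w v * edge_mnm s v = 2 * comp_count r s)%N.
Proof.
move/allP=> es we; rewrite /comp_count -sum1_count [in RHS]big_mkcond [in RHS]big_distrr /=.
under eq_bigr do rewrite edge_mnmE big_distrr /=.
rewrite exchange_big /=; apply: eq_big_seq => a /es/we ea.
have sum_w u : (\sum_v w v * (u == v) = w u)%N.
  by rewrite (bigD1 u) //= eqxx muln1 big1 ?addn0 // => v /negPf; rewrite eq_sym => ->; rewrite muln0.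
under eq_bigr do rewrite mulnDr.
by rewrite big_split /= !sum_w ea; case: eqP.
Qed.

Lemma size_comp_count s : (\sum_(r | roots e r) comp_count r s = size s)%N.
Proof.
rewrite -sum1_size (partition_big (fun a => comp a.1) (roots e)) /= => [|a _].
  by apply: eq_bigr => r _; rewrite sum1_count.
exact: roots_root.
Qed.

Lemma sum_comp (F : 'I_n -> nat) :
  (\sum_(r | roots e r) \sum_(v | comp v == r) F v = \sum_v F v)%N.
Proof.
by rewrite [RHS](partition_big comp (roots e)) //= => v _; apply: roots_root.
Qed.

Lemma card_roots : #|roots e| = num_components e.
Proof. by apply: eq_card => v; rewrite !inE andbT. Qed.

Lemma packs_pred k m i : packs e k (U_(i) + m)%MM ->
  exists s, [/\ edges e s, (k <= (size s).+1)%N & (edge_mnm s <= m)%MM].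
Proof.
case=> t [et kt /mnm_lepP tm].
have [/hasP[a at_ ai]|] := boolP (has (fun a => (a.1 == i) || (a.2 == i)) t).
  have pt := perm_to_rem at_; exists (rem a t); split.
  - by apply/allP => b /mem_rem /(allP et).
  - by rewrite -[(size _).+1](perm_size pt).
  apply/mnm_lepP => v; have := tm v; rewrite !edge_mnmE (perm_big _ pt) big_cons mnmDE mnm1E.
  have : ((i == v) <= (a.1 == v) + (a.2 == v))%N.
    by case: (eqVneq i v) => // <-; case/orP: ai => ->; rewrite ?addn1.
  by move=> le1 le2; rewrite -(leq_add2l (i == v)); apply: leq_trans le2; rewrite leq_add2r.
move/hasPn => nt; exists t; split=> //; first exact: leqW.
apply/mnm_lepP => v; have := tm v; rewrite mnmDE mnm1E.
case: (eqVneq i v) => // <- _; rewrite edge_mnmE big1_seq //= => a /nt.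
by rewrite negb_or => /andP[/negPf-> /negPf->].
Qed.

Lemma packs_lower k m (C : 'I_n -> Prop) :
    (0 < n)%N -> (forall i j, e i j -> C i \/ C j) -> ~ packs e k m ->
    (forall i, C i -> packs e k (U_(i) + m)%MM) ->
  (2 * k + num_components e <= mdeg m + 2)%N.
Proof.
move=> n0 cov npk pk.
(* Every component contains an edge, hence meets the cover [C]. *)
have meetC v : exists2 i, C i & comp i = comp v.
  have [u vu] := e_noisol v; case: (cov _ _ vu); first by exists v.
  by exists u => //; rewrite (edge_comp vu).
have [M [eM kM Mm]] : exists M, [/\ edges e M, (k <= (size M).+1)%N & (edge_mnm M <= m)%MM].
  by have [i Ci _] := meetC (Ordinal n0); apply: packs_pred (pk i Ci).
(* Summed over the components, a surplus of one in each gives the bound, as [M] has at least [k - 1]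
   edges. *)
suff deg_comp r : roots e r -> ((2 * comp_count r M).+1 <= \sum_(v | comp v == r) m v)%N.
  have : (\sum_(r | roots e r) (2 * comp_count r M + 1) <= mdeg m)%N.
    rewrite mdegE -sum_comp; apply: leq_sum => r rr; rewrite addn1; exact: deg_comp.
  rewrite big_split /= -big_distrr /= size_comp_count sum1_card card_roots => le.
  by rewrite -(leq_add2r 2) in le; apply: leq_trans le; rewrite addnAC leq_add2r addnC -mulnS leq_mul2l.
move/eqP=> rr; have [i Ci ir] := meetC r; rewrite rr in ir.
have [s [es ks /mnm_lepP sm]] := pk i Ci.
have le_count : (comp_count r M < comp_count r s)%N.
  rewrite ltnNge; apply/negP => le; apply: npk.
  (* Exchange: the edges of [s] outside component [r] and those of [M] inside it would be at least
     [k] edges dividing [x^m], since [x_i] affects only component [r]. *)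
  exists ([seq a <- s | predC1 r (comp a.1)] ++ [seq a <- M | pred1 r (comp a.1)]); split.
  - rewrite /edges all_cat; apply/andP; split; apply/allP => a; rewrite mem_filter => /andP[_].
      by move/(allP es).
    by move/(allP eM).
  - rewrite size_cat !size_filter; apply: leq_trans ks _.
    rewrite -(count_predC (fun a => comp a.1 == r) s) addnC.
    by apply: leq_add.
  - apply/mnm_lepP => v; rewrite edge_mnm_cat mnmDE !edge_mnm_comp //=.
    case: eqP => [_|vr]; first by rewrite add0n; apply/mnm_lepP.
    rewrite addn0; apply: leq_trans (sm v) _; rewrite mnmDE mnm1E.
    by case: eqP => // iv; case: vr; rewrite -iv.
have w_e i' j' : e i' j' -> ((comp i' == r) + (comp j' == r) = 2 * (comp i' == r))%N.
  by move/edge_comp=> ->; rewrite mul2n addnn.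
have : (2 * comp_count r s <= \sum_v (comp v == r) * (U_(i) + m)%MM v)%N.
  by rewrite -(edge_mnm_weight es w_e); apply: leq_sum => v _; rewrite leq_mul2l sm orbT.
have -> : (\sum_v (comp v == r) * (U_(i) + m)%MM v = 1 + \sum_(v | comp v == r) m v)%N.
  under eq_bigr do rewrite mnmDE mnm1E mulnDr.
  rewrite big_split /=; congr (_ + _)%N.
    rewrite (bigD1 i) //= ir !eqxx big1 // => v /negPf; rewrite eq_sym => ->.
    by rewrite muln0.
  by rewrite [RHS]big_mkcond; apply: eq_bigr => v _; case: eqP; rewrite ?mul1n.
(* The extra edge of [s] brings degree 2, of which [x_i] accounts for 1. *)
rewrite add1n => le; rewrite -ltnS; apply: leq_trans le.
by have := leq_mul (leqnn 2) le_count; rewrite mulnS.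
Qed.

(** * Walks of prescribed parity from the roots *)

(** The bipartite double cover of the graph; the Boolean tracks the parity of the length. *)
Definition parity_step : rel ('I_n * bool) :=
  fun x y => e x.1 y.1 && (y.2 == ~~ x.2).

Definition walk_to (b : bool) (v : 'I_n) : bool :=
  connect parity_step (comp v, false) (v, b).

Lemma walk_to_step b i j : e i j -> walk_to b i -> walk_to (~~ b) j.
Proof.
move=> eij; rewrite /walk_to (edge_comp eij) => wi.
by apply: connect_trans wi (connect1 _); rewrite /parity_step /= eij eqxx.
Qed.

Lemma walk_to_edge b i j : e i j -> walk_to b i = walk_to (~~ b) j.
Proof.
move=> eij; apply/idP/idP; first exact: walk_to_step.
by rewrite e_sym in eij; move/(walk_to_step eij); rewrite negbK.
Qed.

Lemma connect_invariant (T : finType) (d : rel T) (P : T -> Prop) x y :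
  (forall z u, d z u -> P z -> P u) -> P x -> connect d x y -> P y.
Proof.
move=> dP Px /connectP[p]; elim: p x Px => [|z p IHp] x Px /=; first by move=> _ ->.
by case/andP=> /dP/(_ Px)/IHp.
Qed.

Lemma walk_to_exists v : walk_to true v || walk_to false v.
Proof.
have: connect e (comp v) v by rewrite e_csym connect_root.
apply: (connect_invariant (P := fun v => walk_to true v || walk_to false v)) => [i j eij|].
  by rewrite (walk_to_edge true eij) (walk_to_edge false eij) orbC.
by rewrite /walk_to (root_root e_csym) connect0 orbT.
Qed.

(* For a walk v0, v1, v2, ... take the edges v1v2, v3v4, ... for h
   and v0v1, v2v3, ... for h'. *)
Lemma walk_edges (r v : 'I_n) (b : bool) : connect parity_step (r, false) (v, b) ->
  exists h h', [/\ edges e h, edges e h', size h' = (b + size h)%N &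
    (U_(r) + (if b then U_(v) else 0) + edge_mnm h
     = edge_mnm h' + if b then 0 else U_(v))%MM].
Proof.
pose P (x : 'I_n * bool) := exists h h', [/\ edges e h, edges e h',
  size h' = (x.2 + size h)%N &
  (U_(r) + (if x.2 then U_(x.1) else 0) + edge_mnm h
   = edge_mnm h' + if x.2 then 0 else U_(x.1))%MM].
apply: (connect_invariant (P := P)); last first.
  by exists [::], [::]; split=> //=; rewrite edge_mnm_nil !addm0 add0m.
move=> [i a] [j c] /andP[/= eij /eqP->] [h [h' [eh eh' /= sz eqm]]].
have eij' : forall t, edges e t -> edges e ((i, j) :: t) by move=> t et; apply/andP.
case: a sz eqm => sz eqm /=.
  exists ((i, j) :: h), h'; split=> //; first exact: eij'.
  apply/mnmP => l; move/mnmP/(_ l): eqm; rewrite edge_mnm_cons /= !mnmDE !mnm0E; lia.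
exists h, ((i, j) :: h'); split=> //; first exact: eij'.
  by rewrite /= sz.
apply/mnmP => l; move/mnmP/(_ l): eqm; rewrite edge_mnm_cons /= !mnmDE !mnm0E; lia.
Qed.

(** Concatenating the lists [h] of all the odd walks gives one [g] for every [w]: the edges of the
    other walks occur on both sides of the identity. *)
Lemma walk_edges_all (ws : seq 'I_n) : exists2 g, edges e g &
  forall w, w \in ws -> walk_to true w -> exists h,
    [/\ edges e h, size h = (size g).+1 &
     (U_(comp w) + U_(w) + edge_mnm g = edge_mnm h)%MM].
Proof.
elim: ws => [|v ws [g eg gP]]; first by exists [::].
have [wv|nwv] := boolP (walk_to true v); last first.
  exists g => // w; rewrite inE => /orP[/eqP-> wv|]; first by rewrite wv in nwv.
  exact: gP.
have [h [h' [eh eh' sz]]] := walk_edges wv; rewrite addm0 => eqh.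
exists (h ++ g); first by rewrite /edges all_cat; apply/andP.
move=> w; rewrite inE => /orP[/eqP-> _|/gP{}gP /gP[t [et szt eqt]]].
  exists (h' ++ g); split; first by rewrite /edges all_cat; apply/andP.
    by rewrite !size_cat sz.
  by rewrite !edge_mnm_cat addmA eqh.
exists (h ++ t); split; first by rewrite /edges all_cat; apply/andP.
  by rewrite !size_cat szt addnS.
apply/mnmP => l; rewrite !edge_mnm_cat -eqt !mnmDE; lia.
Qed.

(** * The monomial attaining the bound *)

Definition root_mnm : 'X_{1..n} := (\sum_(r | roots e r) U_(r))%MM.

Lemma root_mnmE v : root_mnm v = (roots e v : nat).
Proof.
rewrite /root_mnm mnm_sumE big_mkcond (bigD1 v) //= big1 => [|u /negPf uv].
  by rewrite mnm1E eqxx addn0; case: ifP.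
by rewrite mnm1E uv if_same.
Qed.

Lemma mdeg_root_mnm : mdeg root_mnm = num_components e.
Proof.
by rewrite /root_mnm mdeg_sum; under eq_bigr do rewrite mdeg1; rewrite sum1_card card_roots.
Qed.

(* On a bipartite component [parity_weight] is twice the indicator of the side
   opposite to the root; on a non-bipartite one it is constantly [1]. *)
Definition parity_weight (v : 'I_n) : nat := 1 + walk_to true v - walk_to false v.

Lemma parity_weight_edge i j : e i j -> (parity_weight i + parity_weight j = 2)%N.
Proof.
move=> eij; rewrite /parity_weight -(walk_to_edge true eij) -(walk_to_edge false eij).
by have := walk_to_exists i; case: (walk_to true i); case: (walk_to false i).
Qed.

(** If [m] vanished on the vertices reached by odd walks, its weight would be 0. In component [r]
    the rest weighs at most [2 * comp_count r g + 1], so by parity [s] has no more edges there than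
    [g], against [size g < k]. *)
Lemma packs_odd_walk k m g : edges e g -> (size g < k)%N ->
  packs e k (m + (root_mnm + edge_mnm g))%MM ->
  exists2 i, walk_to true i & (0 < m i)%N.
Proof.
move=> eg gk [s [es ks /mnm_lepP sm]].
suff /existsP[i /andP[wi mi]] : [exists i, walk_to true i && (0 < m i)%N] by exists i.
apply: contraT => /existsPn noB.
suff le_count r : roots e r -> (comp_count r s <= comp_count r g)%N.
  have: (k <= size g)%N; last by rewrite leqNgt gk.
  by rewrite -size_comp_count (leq_trans ks) // -size_comp_count; apply: leq_sum.
move=> rr; pose w v := ((comp v == r) * parity_weight v)%N.
have w_e i j : e i j -> (w i + w j = 2 * (comp i == r))%N.
  by move=> eij; rewrite /w -(edge_comp eij) -mulnDr (parity_weight_edge eij) mulnC.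
rewrite -ltnS -(ltn_pmul2l (m := 2)) // mulnS -(edge_mnm_weight es w_e) -(edge_mnm_weight eg w_e).
rewrite add2n ltnS; apply: (@leq_trans (\sum_v (w v * root_mnm v + w v * edge_mnm g v))).
  apply: leq_sum => v _; rewrite -mulnDr; have := sm v; rewrite !mnmDE.
  have [->|mv] := posnP (m v); first by move=> le; rewrite leq_mul2l le orbT.
  (* Only even walks reach [v], so its weight is [1 + 0 - 1 = 0]. *)
  have nwv : walk_to true v = false by have := noB v; rewrite mv andbT => /negPf.
  have := walk_to_exists v; rewrite nwv /= => wv.
  by rewrite /w /parity_weight nwv wv muln0 mul0n.
(* Of the roots only [r] has weight here, at most 1 because the empty walk is even. *)
rewrite big_split /= -add1n leq_add2r (bigD1 r) //= big1 ?addn0 => [|v /negPf vr].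
  rewrite /w root_mnmE rr muln1 /parity_weight (eqP rr) eqxx mul1n.
  have ->: walk_to false r by rewrite /walk_to (eqP rr) connect0.
  by case: walk_to.
rewrite /w root_mnmE; case rv: (roots e v); last by rewrite muln0.
by rewrite (eqP rv) vr.
Qed.

Lemma root_edges_packs : (0 < n)%N -> exists k0, forall k, (k0 < k)%N ->
  exists g, [/\ edges e g, size g = k.-1 &
    forall i, walk_to true i -> packs e k (U_(i) + (root_mnm + edge_mnm g))%MM].
Proof.
move=> n0; have [g eg gP] := walk_edges_all (enum 'I_n); exists (size g) => k gk.
have [v uv] := e_noisol (Ordinal n0); set u := Ordinal n0 in uv.
(* Copies of an arbitrary edge fill [g] up to [k.-1] edges; this is why [k] must be large. *)
pose pad := nseq (k.-1 - size g) (u, v).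
have epad : edges e pad by apply/allP => a /nseqP[-> _].
have size_pad : (size g + size pad)%N = k.-1.
  by rewrite size_nseq subnKC // -ltnS (ltn_predK gk).
exists (g ++ pad); split; first by rewrite /edges all_cat; apply/andP.
  by rewrite size_cat.
move=> i wi; have [h [eh szh eqh]] := gP i (mem_enum _ _) wi.
exists (h ++ pad); split; first by rewrite /edges all_cat; apply/andP.
  by rewrite size_cat szh addSn size_pad (ltn_predK gk).
apply/mnm_lepP => l; rewrite !edge_mnm_cat -eqh !mnmDE root_mnmE !mnm1E.
have : ((comp i == l) <= roots e l)%N.
  by case: eqP => // <-; rewrite (roots_root e_csym).
move: (edge_mnm g l) (edge_mnm pad l) => x y; case: (comp i == l); case: (roots e l); case: (i == l) => /=; lia.
Qed.

End Components.

(** * The v-number of large powers *)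

Theorem corollary5p4 (K : fieldType) (n : nat) (e : rel 'I_n)
    (n_gt0 : (0 < n)%N) (e_sym : ssrbool.symmetric e) (e_irr : irreflexive e)
    (e_noisol : no_isolated_vertices e) :
  exists k0 : nat, forall k : nat, (k0 <= k)%N ->
    exists v : nat,
      is_vnumber (ideal_exp (edge_ideal K e) k) v /\
      v%:Z = 2 * k%:Z + ((num_components e)%:Z - 2).
Proof.
have [k0 k0P] := root_edges_packs e_sym e_noisol n_gt0.
exists k0.+1 => k k0k; have [g [eg szg gP]] := k0P k k0k.
have k_gt0 : (0 < k)%N by apply: leq_ltn_trans k0k.
pose F := (root_mnm e + edge_mnm g)%MM; exists (mdeg F).
have degF : (mdeg F = num_components e + 2 * k.-1)%N.
  by rewrite mdegD mdeg_root_mnm mdeg_edge_mnm szg.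
split; last first.
  by rewrite degF -[in RHS](prednK k_gt0) -addn1 ; lia.
pose P := var_ideal (K := K) (walk_to e true).
have colonP : ideal_eq (colon (ideal_exp (edge_ideal K e) k) 'X_[F]) P.
  move=> f; split.
    move/ideal_exp_packs => pf; apply/var_idealP => m mf.
    apply: (packs_odd_walk e_sym eg _ (k := k)); first by rewrite szg prednK.
    by apply: pf; rewrite addmC mcoeff_msupp mcoeffMX -mcoeff_msupp.
  move=> /var_idealP fB; apply: packs_ideal_exp => m0 /msuppM_le /allpairsP[[m m'] /= [mf]].
  rewrite msuppX inE => /eqP-> ->{m0}; have [i wi mi] := fB m mf.
  apply: packs_le (gP i wi); apply/mnm_lepP => l; rewrite !mnmDE leq_add2r mnm1E.
  by case: eqP => // <-.
have homF : ('X_[F] : {mpoly K[n]}) \is (mdeg F).-homog by rewrite dhomogX.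
(* A bound for arbitrary primes settles both minima: over degrees at [P] and over all associated
   primes. *)
suff lower d f Q : is_prime_ideal Q -> f \is d.-homog ->
    ideal_eq (colon (ideal_exp (edge_ideal K e) k) f) Q -> (mdeg F <= d)%N.
  have Pass : is_assoc_prime (ideal_exp (edge_ideal K e) k) P.
    by split; [apply: var_ideal_prime | exists 'X_[F]].
  split=> [|d [Q [Qp _] [[f fd fQ] _]]]; last exact: lower Qp fd fQ.
  exists P => //; split; first by exists 'X_[F].
  by move=> d [f fd fP]; apply: lower fd fP; apply: var_ideal_prime.
move=> Qp fd fQ; have [[Q0 _ _] Q1 QM] := Qp.
(* Otherwise [f] would lie in the power and [1] in [Q]. *)
have [m mf npk] : exists2 m, m \in msupp f & ~ packs e k m.
  apply: Classical_Prop.NNPP => nex; apply/Q1/fQ; rewrite /colon mul1r.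
  apply: packs_ideal_exp => m mf; apply: Classical_Prop.NNPP => npk.
  by apply: nex; exists m.
have cover i j : e i j -> Q 'X_i \/ Q 'X_j.
  (* The [k]-th power of [x_i x_j] lies in the ideal power, hence in [Q], and [Q] is prime. *)
  move=> eij; apply/QM/(prime_ideal_exp (k := k) Qp)/fQ; rewrite /colon mulrC.
  have [_ _ IM] := ideal_exp_ideal (edge_ideal K e) k; apply: IM.
  have -> : ('X_i * 'X_j : {mpoly K[n]}) ^+ k = 'X_[edge_mnm (nseq k (i, j))].
    rewrite -mpolyXD mpolyXn; congr 'X_[_]; elim: (k) => [|l IHl].
      by rewrite edge_mnm_nil.
    by rewrite edge_mnm_cons -IHl mulmS.
  apply: edge_mnm_ideal_exp; last by rewrite size_nseq.
  by apply/allP => a /nseqP[-> _].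
have := packs_lower e_sym e_noisol n_gt0 cover npk.
have -> : mdeg m = d by apply: (dhomog_mf fd).
(* Multiplying by one variable merely shifts the support of [f], so no term cancels. *)
have shift i : Q 'X_i -> packs e k (U_(i) + m)%MM.
  move=> /fQ /ideal_exp_packs; apply.
  by rewrite mulrC mcoeff_msupp mcoeffMX -mcoeff_msupp.
by move/(_ shift); rewrite degF; lia.
Qed.
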